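(* Let $K$ be a compact Hausdorff space and $X$ be a complex Banach space. If $X$ has the Daugavet property, then $A(K,X)$ also has the Daugavet property.
   Context: All Banach spaces are complex. $C(K,X)$ is the Banach space of continuous functions $K\to X$ with the supremum norm, and $C(K)=C(K,\mathbb{C})$. A uniform algebra on $K$ is a closed subspace (subalgebra) of $C(K)$ that separates the points of $K$ and contains the constants. $A(K,X)$ denotes a closed subspace of $C(K,X)$ such that: (i) the base algebra $A=\{x^*\circ f: f\in A(K,X),\ x^*\in X^*\}$ is a uniform algebra; (ii) $A\otimes X\subset A(K,X)$ (i.e. $t\mapsto\varphi(t)x$ is in $A(K,X)$ for $\varphi\in A$, $x\in X$); (iii) $fg\in A(K,X)$ for every $f\in A$, $g\in A(K,X)$. A Banach space $Z$ has the Daugavet property if $\|\mathrm{Id}_Z+T\|=1+\|T\|$ for every rank-one bounded linear operator $T:Z\to Z$. *)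

(* Defs.v *)
From HB Require Import structures.
From mathcomp Require Import all_boot all_order all_algebra.
From mathcomp Require Import complex.
From mathcomp Require Import all_classical all_reals all_analysis.

Set Implicit Arguments.
Unset Strict Implicit.
Unset Printing Implicit Defensive.

Import Order.TTheory GRing.Theory Num.Theory.
Import numFieldNormedType.Exports.

Local Open Scope classical_set_scope.
Local Open Scope ring_scope.
Local Open Scope complex_scope.

(* Norms of complex normed spaces are valued in [R[i]], where they are
   nonnegative reals; [rnorm] is the same number seen in [R]. *)
Section RealNorm.
Context {R : realType} {Z : normedModType R[i]}.
Implicit Types z w : Z.

Definition rnorm z : R := complex.Re `|z|.

Lemma rnormE z : `|z| = (rnorm z)%:C.
Proof. by rewrite RRe_real// ger0_real. Qed.

Lemma rnorm_ge0 z : 0 <= rnorm z.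
Proof. by rewrite -ler0c -rnormE. Qed.

Lemma rnormD z w : rnorm (z + w) <= rnorm z + rnorm w.
Proof. by rewrite -lecR rmorphD/= -!rnormE ler_normD. Qed.

Lemma rnormN z : rnorm (- z) = rnorm z.
Proof. by rewrite /rnorm normrN. Qed.

Lemma rnorm_dist z w : `|rnorm z - rnorm w| <= rnorm (z - w).
Proof.
rewrite ler_norml lerNl opprB !lerBlDr; apply/andP; split.
  by rewrite -(rnormN (z - w)) opprB; apply: le_trans (rnormD _ _); rewrite subrK.
by apply: le_trans (rnormD _ _); rewrite subrK.
Qed.

Lemma rnorm_continuous : continuous (rnorm : Z -> R).
Proof.
move=> z; apply/cvgrPdist_lt => e e0.
have eC0 : 0 < e%:C :> R[i] by rewrite (_ : 0 = 0%:C)// ltcR.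
have /cvgrPdist_lt/(_ _ eC0) := @cvg_id _ (nbhs z).
apply: filterS => w; rewrite rnormE ltcR; exact/le_lt_trans/rnorm_dist.
Qed.

End RealNorm.

Lemma rnormZ {R : realType} {Z : normedModType R[i]} (a : R[i]) (z : Z) :
  rnorm (a *: z) = rnorm (a : R[i]^o) * rnorm z.
Proof. by apply: complexI; rewrite rmorphM /= -!rnormE normrZ. Qed.

Section ContinuousFunctions.
Context {R : realType} {K : topologicalType} {X : normedModType R[i]}.

Definition cts_pred : {pred K -> X} := mem [set f : K -> X | continuous f].

Lemma cts_predP (f : K -> X) : reflect (continuous f) (f \in cts_pred).
Proof. by apply: (iffP idP) => [/set_mem|?]; [|apply/mem_set]. Qed.

Lemma cts_submod_closed : GRing.submod_closed cts_pred.
Proof.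
split; first by apply/cts_predP => t; exact: cst_continuous.
move=> a f g /cts_predP cf /cts_predP cg; apply/cts_predP => t.
by apply: cvgD; [apply: cvgZ; [exact: cvg_cst|exact: cf]|exact: cg].
Qed.

HB.instance Definition _ :=
  GRing.isSubmodClosed.Build R[i] (K -> X) cts_pred cts_submod_closed.

End ContinuousFunctions.

(* C(K, X). Compactness of K is a parameter of the type because the supremum
   norm needs the functions to be bounded. *)
Record cspace {R : realType} {K : topologicalType} (Kc : compact [set: K])
    (X : normedModType R[i]) := CSpace {
  cspace_fun :> K -> X;
  _ : cspace_fun \in cts_pred }.

Section SupremumNorm.
Context {R : realType} {K : topologicalType} {Kc : compact [set: K]}.
Context {X : normedModType R[i]}.
Local Notation CKX := (cspace Kc X).
Implicit Types f g : CKX.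

HB.instance Definition _ := [isSub for @cspace_fun R K Kc X].
HB.instance Definition _ := [Choice of CKX by <:].
HB.instance Definition _ := [SubChoice_isSubLmodule of CKX by <:].

Lemma cspaceP f g : f =1 g -> f = g.
Proof. by move=> fg; apply: val_inj; apply: funext. Qed.

Lemma cspace_cts f : continuous f.
Proof. exact/cts_predP/(valP f). Qed.

Definition supnorm f : R := sup [set rnorm (f t) | t in [set: K]].

Lemma supnorm_has_ub f : has_ubound [set rnorm (f t) | t in [set: K]].
Proof.
have : compact [set rnorm (f t) | t in [set: K]].
  apply: continuous_compact => //; apply: continuous_subspaceT => t.
  by apply: continuous_comp; [exact: cspace_cts|exact: rnorm_continuous].
by case: (pselect ([set rnorm (f t) | t in [set: K]] !=set0))
  => [n0 /(compact_has_sup n0)[]//|/set0P/negP/negPn/eqP -> _]; exists 0.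
Qed.

Lemma rnorm_le_supnorm f t : rnorm (f t) <= supnorm f.
Proof. by apply: ub_le_sup; [exact: supnorm_has_ub|exists t]. Qed.

Lemma supnorm_ge0 f : 0 <= supnorm f.
Proof.
have [[t _]|/set0P/negP/negPn/eqP K0] := pselect ([set: K] !=set0).
  exact: le_trans (rnorm_ge0 _) (rnorm_le_supnorm f t).
by rewrite /supnorm K0 image_set0 sup0.
Qed.

Lemma supnorm_le f (M : R) :
  0 <= M -> (forall t, rnorm (f t) <= M) -> supnorm f <= M.
Proof.
move=> M0 fM; have [[t _]|/set0P/negP/negPn/eqP K0] := pselect ([set: K] !=set0).
  by apply: ge_sup => [|_ [s _ <-]//]; exists (rnorm (f t)), t.
by rewrite /supnorm K0 image_set0 sup0.
Qed.

Definition cspace_norm f : R[i] := (supnorm f)%:C.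

Lemma cspace_normD f g : cspace_norm (f + g) <= cspace_norm f + cspace_norm g.
Proof.
rewrite -rmorphD/= lecR; apply: supnorm_le => [|t].
  by rewrite addr_ge0// supnorm_ge0.
by apply: le_trans (rnormD _ _) _; apply: lerD; exact: rnorm_le_supnorm.
Qed.

Lemma supnormZ_le (a : R[i]) f :
  supnorm (a *: f) <= rnorm (a : R[i]^o) * supnorm f.
Proof.
apply: supnorm_le => [|t]; first by rewrite mulr_ge0 ?rnorm_ge0 ?supnorm_ge0.
rewrite [X in rnorm X](_ : _ = a *: f t)// rnormZ.
by rewrite ler_wpM2l ?rnorm_ge0 ?rnorm_le_supnorm.
Qed.

Lemma cspace_normZ (a : R[i]) f : cspace_norm (a *: f) = `|a| * cspace_norm f.
Proof.
rewrite [X in X * _](rnormE (a : R[i]^o)) -rmorphM; congr _%:C.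
apply/eqP; rewrite eq_le supnormZ_le andTb.
have [->|a0] := eqVneq a 0; first by rewrite /rnorm normr0 mul0r supnorm_ge0.
have fE : f = a^-1 *: (a *: f) by rewrite scalerK.
have rK : rnorm (a : R[i]^o) * rnorm (a^-1 : R[i]^o) = 1.
  by rewrite -rnormZ [_ *: _]divff// /rnorm normr1.
rewrite {1}fE; apply: (le_trans (ler_wpM2l (rnorm_ge0 _) (supnormZ_le _ _))).
by rewrite mulrA rK mul1r.
Qed.

Lemma cspace_norm0_eq0 f : cspace_norm f = 0 -> f = 0.
Proof.
move=> [f0]; apply: cspaceP => t; apply/eqP; rewrite -normr_le0 rnormE.
by rewrite (_ : 0 = 0%:C)// lecR -f0 rnorm_le_supnorm.
Qed.

HB.instance Definition _ := @Lmodule_isNormed.Build R[i] CKX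
  cspace_norm cspace_normD cspace_normZ cspace_norm0_eq0.

End SupremumNorm.

Section Subspace.
Context {R : realType} {V : normedModType R[i]} (S : submodClosed V).

(* The linear subspace S of V as a normed space of its own. *)
Record subspace_of := SubspaceOf { subspace_val :> V; _ : subspace_val \in S }.

HB.instance Definition _ := [isSub for subspace_val].
HB.instance Definition _ := [Choice of subspace_of by <:].
HB.instance Definition _ := [SubChoice_isSubLmodule of subspace_of by <:].

Implicit Types f g : subspace_of.

Definition subspace_norm f : R[i] := `|val f|.

Lemma subspace_normD f g :
  subspace_norm (f + g) <= subspace_norm f + subspace_norm g.
Proof. by rewrite /subspace_norm raddfD ler_normD. Qed.

Lemma subspace_normZ (a : R[i]) f :
  subspace_norm (a *: f) = `|a| * subspace_norm f.
Proof. by rewrite /subspace_norm linearZ normrZ. Qed.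

Lemma subspace_norm0_eq0 f : subspace_norm f = 0 -> f = 0.
Proof. by move=> /normr0_eq0 f0; apply: val_inj; rewrite f0 raddf0. Qed.

HB.instance Definition _ := @Lmodule_isNormed.Build R[i] subspace_of
  subspace_norm subspace_normD subspace_normZ subspace_norm0_eq0.

End Subspace.

Section Daugavet.
Context {R : realType} (Z : normedModType R[i]).

Definition opnorm (T : Z -> Z) : R :=
  sup [set rnorm (T z) | z in [set z : Z | `|z| <= 1]].

(* Rank exactly one: T = 0 is excluded, so the zero space trivially has the
   Daugavet property. *)
Definition rank_one (T : Z -> Z) : Prop :=
  exists2 z : Z, z != 0 & range T = range (fun a : R[i] => a *: z).

Definition daugavet : Prop :=
  forall T : {linear Z -> Z}, continuous T -> rank_one T ->
    opnorm (fun z => z + T z) = 1 + opnorm T.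

End Daugavet.

Section BaseAlgebra.
Context {R : realType} {K : topologicalType} {Kc : compact [set: K]}.
Local Notation CK := (cspace Kc R[i]^o).

Definition cspace_cst {X : normedModType R[i]} (x : X) : cspace Kc X :=
  CSpace Kc (introT (cts_predP (fun=> x)) (@cst_continuous K X x)).

Lemma cspace_scale_subproof {X : normedModType R[i]}
    (a : CK) (f : cspace Kc X) :
  (fun t => (a t : R[i]) *: f t) \in (cts_pred : {pred K -> X}).
Proof. by apply/cts_predP => t; apply: cvgZ; exact: cspace_cts. Qed.

(* The pointwise product; for X = C this is the multiplication of C(K). *)
Definition cspace_scale {X : normedModType R[i]}
    (a : CK) (f : cspace Kc X) : cspace Kc X :=
  CSpace Kc (cspace_scale_subproof a f).

Definition uniform_algebra (A : set CK) : Prop :=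
  [/\ closed A,
      (forall (c : R[i]) (a b : CK), A a -> A b -> A (c *: a + b)),
      (forall a b : CK, A a -> A b -> A (cspace_scale a b)),
      (forall c : R[i], A (cspace_cst (c : R[i]^o))) &
      (forall s t : K, s <> t -> exists2 a : CK, A a & a s <> a t)].

Context {X : normedModType R[i]}.

Definition base_algebra (S : submodClosed (cspace Kc X)) : set CK :=
  [set a | exists (f : cspace Kc X) (phi : {linear X -> R[i]^o}),
     [/\ f \in S, continuous phi & forall t, a t = phi (f t)]].

Definition is_AKX (S : submodClosed (cspace Kc X)) : Prop :=
  [/\ closed [set f | f \in S],
      uniform_algebra (base_algebra S),
      (forall a (x : X), base_algebra S a ->
         cspace_scale a (cspace_cst x) \in S) &
      (forall a f, base_algebra S a -> f \in S -> cspace_scale a f \in S)].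

End BaseAlgebra.

(* Main.v *)
(* A Banach space Z has the Daugavet property iff for every functional phi,
   every h in the unit ball and every u <> 0 there is y in the ball with
   Re phi(y) > Re phi(h) - e and ||y + u|| > 1 + ||u|| - e.  Let A be the base
   algebra of A(K, X).  A norming functional applied to u in A(K, X) gives an
   element of A, so ||u(.)|| attains its maximum at a peak point p of A
   (a minimal peak set, obtained by Zorn's lemma).  Averaging peak functions on
   nested neighbourhoods of p produces a in A with a(p) close to 1, a small
   away from p and |a| + |1 - a| <= 1 + d everywhere.  If y in X is given by the
   characterisation for the functional x |-> phi(a x) and the vectors h(p),
   u(p), then g = h + a (y - h(p)) is as required in A(K, X). *)
Require Import Defs.
From HB Require Import structures.
From mathcomp Require Import all_boot all_order all_algebra.
From mathcomp Require Import complex ring lra.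
From mathcomp Require Import all_classical all_reals all_analysis.

Set Implicit Arguments.
Unset Strict Implicit.
Unset Printing Implicit Defensive.

Import Order.TTheory GRing.Theory Num.Theory.
Import numFieldNormedType.Exports.

Local Open Scope classical_set_scope.
Local Open Scope ring_scope.
Local Open Scope complex_scope.

(** * Real-valued norms, scalars and bounded linear maps *)

Section RealNormTheory.
Context {R : realType} {Z : normedModType R[i]}.
Implicit Types z w : Z.

Lemma rnorm0 : rnorm (0 : Z) = 0.
Proof. by rewrite /rnorm normr0. Qed.

Lemma rnorm_eq0 z : (rnorm z == 0) = (z == 0).
Proof.
apply/eqP/eqP => [z0|->]; last exact: rnorm0.
by apply/eqP; rewrite -normr_eq0 rnormE z0.
Qed.

Lemma rnorm_gt0 z : (0 < rnorm z) = (z != 0).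
Proof. by rewrite lt_def rnorm_ge0 andbT rnorm_eq0. Qed.

Lemma rnorm_distC z w : rnorm (z - w) = rnorm (w - z).
Proof. by rewrite -rnormN opprB. Qed.

Lemma rnorm_leB z w : rnorm z - rnorm w <= rnorm (z - w).
Proof. by rewrite lerBlDr (le_trans _ (rnormD _ _))// subrK. Qed.

Lemma normr_le1 z : (`|z| <= 1) = (rnorm z <= 1).
Proof. by rewrite rnormE (_ : 1 = 1%:C)// lecR. Qed.

End RealNormTheory.

Section ScalarRealNorm.
Context {R : realType}.

Lemma rnorm_real (r : R) : rnorm (r%:C : R[i]^o) = `|r|.
Proof. by rewrite /rnorm normc_def /= expr0n addr0 sqrtr_sqr. Qed.

Lemma rnormZr {Z : normedModType R[i]} (r : R) (z : Z) :
  rnorm (r%:C *: z) = `|r| * rnorm z.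
Proof. by rewrite rnormZ rnorm_real. Qed.

Lemma rnorm1 : rnorm (1 : R[i]^o) = 1.
Proof. by rewrite /rnorm normr1. Qed.

Lemma rnormM (a b : R[i]) :
  rnorm (a * b : R[i]^o) = rnorm (a : R[i]^o) * rnorm (b : R[i]^o).
Proof. exact: (@rnormZ R R[i]^o). Qed.

Lemma ler_Re_rnorm (a : R[i]) : complex.Re a <= rnorm (a : R[i]^o).
Proof.
apply: le_trans (ler_norm _) _.
by rewrite -lecR -rnormE; exact: normc_ge_Re.
Qed.

Lemma rnorm_sqr (a : R[i]) :
  rnorm (a : R[i]^o) ^+ 2 = complex.Re a ^+ 2 + complex.Im a ^+ 2.
Proof. by apply: complexI; rewrite add_Re2_Im2 rmorphXn/= -rnormE. Qed.

Lemma ex_phase (a : R[i]) : exists2 c : R[i],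
  rnorm (c : R[i]^o) = 1 & c * a = (rnorm (a : R[i]^o))%:C.
Proof.
have [->|a0] := eqVneq a 0.
  by exists 1; rewrite ?rnorm1// mulr0 rnorm0.
have na0 : rnorm (a : R[i]^o) != 0 by rewrite rnorm_eq0.
exists ((rnorm (a : R[i]^o))%:C * a^-1).
  rewrite rnormM rnorm_real ger0_norm ?rnorm_ge0//.
  by apply: (mulIf na0); rewrite -mulrA -rnormM mulVf// rnorm1 mulr1 mul1r.
by rewrite -mulrA mulVf// mulr1.
Qed.

End ScalarRealNorm.

Section ContinuousLinear.
Context {R : realType} {V W : normedModType R[i]}.

Lemma continuous_linear_rnorm (f : {linear V -> W}) : continuous f ->
  exists2 C : R, 0 < C & forall z, rnorm (f z) <= C * rnorm z.
Proof.
move=> /linear_bounded_continuous/linear_boundedP/pinfty_ex_gt0[M M0 fM].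
have ME : M = (complex.Re M)%:C by rewrite RRe_real// gtr0_real.
exists (complex.Re M) => [|z]; first by rewrite -ltcR -ME.
by move: (fM z); rewrite ME !rnormE -rmorphM lecR.
Qed.

Lemma linear_rnorm_continuous (f : {linear V -> W}) (C : R) :
  (forall z, rnorm (f z) <= C * rnorm z) -> continuous f.
Proof.
move=> fC; apply/linear_bounded_continuous/bounded_funP => r.
exists (`|C|%:C * r) => x xr; rewrite rnormE.
apply: le_trans (_ : (`|C| * rnorm x)%:C <= _).
  rewrite lecR (le_trans (fC x))// ler_wpM2r ?rnorm_ge0//; exact: ler_norm.
by rewrite rmorphM/= -rnormE ler_wpM2l// ler0c.
Qed.

End ContinuousLinear.

(** * Norming functionals *)

Section HahnBanach.
Context {R : realType} {X : normedModType R[i]}.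
Implicit Types (p q : X -> R) (x y : X).

(** Only real scalars occur, since the extension argument treats [X] as a real space. Homogeneity is
    an inequality; applied to [r^-1] as well, it becomes an equality for [r > 0]. *)
Definition sublinear p :=
  (forall x y, p (x + y) <= p x + p y) /\
  (forall (r : R) x, 0 <= r -> p (r%:C *: x) <= r * p x).

Lemma sublinearZ p (r : R) x : sublinear p -> 0 < r -> p (r%:C *: x) = r * p x.
Proof.
move=> [_ pZ] r0; apply/eqP; rewrite eq_le pZ ?(ltW r0)//=.
have rC : r%:C != 0 by rewrite -(rmorph0 (real_complex R)) (inj_eq (@complexI _)) gt_eqF.
have rV : 0 <= r^-1 by rewrite invr_ge0 ltW.
rewrite mulrC -ler_pdivlMr// mulrC; apply: le_trans (pZ r^-1 (r%:C *: x) rV).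
by rewrite scalerA fmorphV mulVf// scale1r.
Qed.

Lemma sublinear0 p : sublinear p -> p 0 = 0.
Proof.
move=> [pD pZ]; apply/eqP; rewrite eq_le; apply/andP; split.
  by have := pZ 0 0 (lexx _); rewrite scaler0 mul0r.
by have := pD 0 0; rewrite addr0 -subr_ge0 addrK.
Qed.

Lemma sublinearN p x : sublinear p -> - p (- x) <= p x.
Proof.
by move=> sp; rewrite lerNl -subr_ge0 opprK -(sublinear0 sp) -(subrr x) addrC sp.1.
Qed.

(** The pointwise infimum works: of two members of the chain, the smaller one can be used at both
    arguments, which gives subadditivity. *)
Lemma sublinear_chain_inf (C : set (X -> R)) p : C p ->
  (forall q, C q -> sublinear q) ->
  (forall q1 q2, C q1 -> C q2 -> (forall x, q1 x <= q2 x) \/ (forall x, q2 x <= q1 x)) ->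
  exists2 m, sublinear m & forall q, C q -> forall x, m x <= q x.
Proof.
move=> Cp Csub Ctot; pose V x := [set q x | q in C].
have V0 x : V x !=set0 by exists (p x), p.
have Vlb x : has_lbound (V x).
  (* If [p <= q], then [- p (- x) <= p x <= q x]; if [q <= p], then
     [- p (- x) <= - q (- x) <= q x]. *)
  exists (- p (- x)) => _ [q Cq <-].
  have [pq|qp] := Ctot _ _ Cp Cq.
    exact: le_trans (sublinearN x (Csub _ Cp)) (pq x).
  by apply: le_trans (sublinearN x (Csub _ Cq)); rewrite lerN2.
have infV q x : C q -> inf (V x) <= q x by move=> Cq; apply: ge_inf => //; exists q.
exists (fun x => inf (V x)) => [|q Cq x]; last exact: infV.
split=> [x y|r x r0] /=.
  rewrite -lerBlDr; apply: lb_le_inf => // _ [q1 Cq1 <-].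
  rewrite lerBlDr -lerBlDl; apply: lb_le_inf => // _ [q2 Cq2 <-].
  rewrite lerBlDl; have [q12|q21] := Ctot _ _ Cq1 Cq2.
    apply: le_trans (infV _ _ Cq1) _; apply: le_trans ((Csub _ Cq1).1 _ _) _.
    by rewrite lerD2l.
  apply: le_trans (infV _ _ Cq2) _; apply: le_trans ((Csub _ Cq2).1 _ _) _.
  by rewrite lerD2r.
have [->|rn0] := eqVneq r 0.
  by rewrite mul0r scale0r -(sublinear0 (Csub _ Cp)) infV.
have rp : 0 < r by rewrite lt_def rn0.
rewrite mulrC -ler_pdivrMr//; apply: lb_le_inf => // _ [q Cq <-].
rewrite ler_pdivrMr// mulrC; apply: le_trans (infV _ _ Cq) _.
exact: (Csub _ Cq).2.
Qed.

(* Lowers [p] in the direction [- y]; a minimal sublinear functional is fixed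
   by every such operation, hence odd. *)
Definition sublinear_shift p y x :=
  inf [set p (x + r%:C *: y) - r * p y | r in [set r : R | 0 <= r]].

Section Shift.
Variables (p : X -> R) (y : X).
Hypothesis sp : sublinear p.

Let shift_le (r : R) x : 0 <= r ->
  sublinear_shift p y x <= p (x + r%:C *: y) - r * p y.
Proof.
move=> r0; apply: ge_inf; last by exists r.
(* The infimum is finite because [s * p y <= p (x + s y) + p (- x)]. *)
exists (- p (- x)) => _ [s /= s0 <-].
have := sp.1 (x + s%:C *: y) (- x); rewrite addrAC subrr add0r.
have [->|sn0] := eqVneq s 0.
  by rewrite scale0r mul0r subr0 addr0 sublinear0// -lerBlDr sub0r.
by rewrite (sublinearZ y sp) ?lt_def ?sn0//; lra.
Qed.

Let le_shift (m : R) x :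
  (forall r : R, 0 <= r -> m <= p (x + r%:C *: y) - r * p y) ->
  m <= sublinear_shift p y x.
Proof.
move=> mx; apply: lb_le_inf; first by exists (p (x + 0%:C *: y) - 0 * p y), 0 => /=.
by move=> _ [r /= r0 <-]; exact: mx.
Qed.

Lemma sublinear_shift_le x : sublinear_shift p y x <= p x.
Proof. by have := shift_le x (lexx 0); rewrite scale0r addr0 mul0r subr0. Qed.

Lemma sublinear_shiftN : sublinear_shift p y (- y) <= - p y.
Proof.
by have := shift_le (- y) ler01; rewrite scale1r addNr sublinear0// mul1r sub0r.
Qed.

(** For a sum, the parameters [r] and [s] of the two infima combine into [r + s]; for a dilation by
    [r], the parameter [s] becomes [r * s]. *)
Lemma sublinear_shift_sublinear : sublinear (sublinear_shift p y).
Proof.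
split=> [u v|r u r0].
  rewrite -lerBlDr; apply: le_shift => r r0.
  rewrite lerBlDr -lerBlDl; apply: le_shift => s s0; rewrite lerBlDl.
  apply: le_trans (shift_le _ (addr_ge0 r0 s0)) _.
  have := sp.1 (u + r%:C *: y) (v + s%:C *: y).
  by rewrite addrACA -scalerDl -rmorphD/=; lra.
have [->|rn0] := eqVneq r 0.
  rewrite mul0r scale0r; apply: le_trans (sublinear_shift_le _) _.
  by rewrite sublinear0.
have rp : 0 < r by rewrite lt_def rn0.
rewrite mulrC -ler_pdivrMr//; apply: le_shift => s s0.
rewrite ler_pdivrMr// mulrC; apply: le_trans (shift_le _ (mulr_ge0 r0 s0)) _.
by rewrite rmorphM/= -scalerA -scalerDr (sublinearZ _ sp)// mulrBr mulrA.
Qed.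

End Shift.

Lemma ex_minimal_sublinear p : sublinear p -> exists q,
  [/\ sublinear q, forall x, q x <= p x & forall x, q (- x) = - q x].
Proof.
move=> sp; pose T := {q : X -> R | sublinear q /\ forall x, q x <= p x}.
(* The order is reversed, so that Zorn's lemma produces a minimal functional. *)
pose rT (q1 q2 : T) := `[< forall x, sval q2 x <= sval q1 x >].
have [|||[q [sq qp]] qmin] := @ZL_preorder T (exist _ p (conj sp (fun x => lexx _))) rT.
- by move=> q; apply/asboolP.
- move=> q1 q2 q3 /asboolP q12 /asboolP q23; apply/asboolP => x.
  exact: le_trans (q23 x) (q12 x).
- move=> A Atot; have [[q0 Aq0]|/set0P/negP/negPn/eqP ->] :=
    pselect (A !=set0); last first.
    by exists (exist _ p (conj sp (fun x => lexx _))).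
  have [|||m sm mA] := @sublinear_chain_inf [set sval q | q in A] (sval q0).
  + by exists q0.
  + by move=> _ [q Aq <-]; exact: (svalP q).1.
  + move=> _ _ [q1 Aq1 <-] [q2 Aq2 <-].
    by have [/asboolP|/asboolP] := Atot _ _ Aq1 Aq2; [right|left].
  have mp x : m x <= p x.
    by apply: le_trans (mA _ _ x) ((svalP q0).2 x); exists q0.
  exists (exist _ m (conj sm mp)) => q Aq; apply/asboolP => x /=.
  by apply: mA; exists q.
exists q; split=> // x; apply/eqP; rewrite eq_le; apply/andP; split; last first.
  by rewrite lerNl sublinearN.
have ssq := sublinear_shift_sublinear x sq.
have sqp z : sublinear_shift q x z <= p z.
  exact: le_trans (sublinear_shift_le x sq z) (qp z).
have qle : rT (exist _ q (conj sq qp)) (exist _ _ (conj ssq sqp)).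
  by apply/asboolP => z; exact: sublinear_shift_le.
have /asboolP/(_ (- x)) /= := qmin _ qle.
by move/le_trans; apply; exact: sublinear_shiftN.
Qed.

(** The minimal functional is sought below the norm already shifted along [x]. That shift is at most
    [- rnorm x] at [- x], so any odd [q] below it has [q x >= rnorm x]. *)
Lemma norming_real_functional x : exists q : X -> R,
  [/\ forall y z, q (y + z) = q y + q z, forall (r : R) y, q (r%:C *: y) = r * q y,
      forall y, q y <= rnorm y & q x = rnorm x].
Proof.
have sn : sublinear (@rnorm R X).
  by split=> [y z|r y r0]; rewrite ?rnormD// rnormZr ger0_norm.
have [q [sq qs qN]] := ex_minimal_sublinear (sublinear_shift_sublinear x sn).
have qn y : q y <= rnorm y by exact: le_trans (qs y) (sublinear_shift_le x sn y).
exists q; split=> //.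
- move=> y z; apply/eqP; rewrite eq_le sq.1/=.
  by have := sq.1 (y + z) (- z); rewrite addrK qN lerBrDr.
- have qZ (r : R) y : 0 < r -> q (r%:C *: y) = r * q y by exact: sublinearZ.
  move=> r y; case: (ltgtP r 0) => [r0|r0|->]; last 1 first.
  + by rewrite scale0r mul0r sublinear0.
  + have := qZ (- r) y; rewrite oppr_gt0 => /(_ r0).
    by rewrite rmorphN scaleNr qN mulNr => /oppr_inj.
  + exact: qZ.
- apply/eqP; rewrite eq_le qn/= -lerN2 -qN.
  exact: le_trans (qs _) (sublinear_shiftN x sn).
Qed.

(** The real functional [q] is the real part of the complex-linear [y |-> q y - i q (i y)]. A phase
    on [y] makes this value real and nonnegative, so the bound on [q] passes to the modulus. *)
Lemma norming_functional x : exists2 phi : {linear X -> R[i]^o},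
  (forall y, rnorm (phi y) <= rnorm y) & rnorm x <= rnorm (phi x).
Proof.
have [q [qD qZ qn qx]] := norming_real_functional x.
pose phi y : R[i]^o := q y -i* q ('i *: y).
have phiE y : phi y = q y -i* q ('i *: y) by [].
have cE (a b : R) : a +i* b = a%:C + b%:C * 'i by rewrite [LHS]complexE mulrC.
have philin : linear phi.
  move=> [a b] y z; rewrite !phiE.
  have -> : 'i *: ((a +i* b) *: y + z) =
      a%:C *: ('i *: y) + ((- b)%:C *: y + 'i *: z).
    rewrite scalerDr addrA; congr (_ + _).
    rewrite !scalerA -scalerDl; congr (_ *: _).
    by apply/eqP; rewrite eq_complex /=; apply/andP; split; apply/eqP; ring.
  have -> : (a +i* b) *: y + z = a%:C *: y + (b%:C *: ('i *: y) + z).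
    by rewrite addrA scalerA -scalerDl -cE.
  rewrite !qD !qZ; apply/eqP; rewrite eq_complex /=.
  by apply/andP; split; apply/eqP; ring.
pose phiL : {linear X -> R[i]^o} := HB.pack phi (GRing.isLinear.Build _ _ _ _ phi philin).
exists phiL => [y|]; last by rewrite -qx; exact: (ler_Re_rnorm (phi x)).
have [c c1 cphi] := ex_phase (phi y).
have : phiL (c *: y) = (rnorm (phi y))%:C by rewrite linearZ.
move=> /(congr1 (@complex.Re R)) /= <-.
by apply: le_trans (qn _) _; rewrite rnormZ c1 mul1r.
Qed.

End HahnBanach.

(** * Slice form of the Daugavet property *)

Section BallSup.
Context {R : realType} {Z : normedModType R[i]}.
Variables (F : Z -> R) (C : R).

(** Covers norms of operators and of functionals alike; [opnorm T] is convertible to an instance. *)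
Definition ball_sup := sup [set F z | z in [set z : Z | `|z| <= 1]].

Hypothesis FC : forall z, rnorm z <= 1 -> F z <= C.

Lemma le_ball_sup z : rnorm z <= 1 -> F z <= ball_sup.
Proof.
move=> z1; apply: ub_le_sup; last by exists z => //=; rewrite normr_le1.
by exists C => _ [w /= w1 <-]; apply: FC; rewrite -normr_le1.
Qed.

Lemma ball_sup_le (M : R) : (forall z, rnorm z <= 1 -> F z <= M) -> ball_sup <= M.
Proof.
move=> FM; apply: ge_sup; first by exists (F 0), 0 => //=; rewrite normr0 ler01.
by move=> _ [w /= w1 <-]; apply: FM; rewrite -normr_le1.
Qed.

Lemma ball_sup_adherent (M : R) :
  M < ball_sup -> exists2 z, rnorm z <= 1 & M < F z.
Proof.
move=> Ms; apply/not_exists2P => FM; move: Ms; apply/negP; rewrite -leNgt.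
apply: ball_sup_le => z z1; rewrite leNgt; apply/negP => Mz.
by case: (FM z).
Qed.

End BallSup.

Lemma rnorm_le_ball_sup {R : realType} {Z W : normedModType R[i]}
    (f : {linear Z -> W}) (z : Z) : continuous f ->
  rnorm (f z) <= ball_sup (fun w => rnorm (f w)) * rnorm z.
Proof.
move=> /continuous_linear_rnorm[C C0 fC].
have fC1 w : rnorm w <= 1 -> rnorm (f w) <= C.
  by move=> w1; apply: le_trans (fC w) _; rewrite ler_piMr// ltW.
have [->|z0] := eqVneq z 0; first by rewrite linear0 !rnorm0 mulr0.
have nz0 : 0 < rnorm z by rewrite rnorm_gt0.
have /(le_ball_sup fC1) : rnorm ((rnorm z)^-1%:C *: z) <= 1.
  by rewrite rnormZr ger0_norm ?invr_ge0 ?rnorm_ge0// mulVf// gt_eqF.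
rewrite linearZ/= rnormZr ger0_norm ?invr_ge0 ?rnorm_ge0//.
by rewrite mulrC ler_pdivrMr.
Qed.

Lemma opnormE {R : realType} {Z : normedModType R[i]} (T : Z -> Z) :
  opnorm T = ball_sup (fun z => rnorm (T z)).
Proof. by []. Qed.

(** The slice is measured from the value at a point [h] of the ball rather than from the norm of
    [phi], so neither [phi] nor [u] is normalised and [phi] may vanish. *)
Definition daugavet_slice {R : realType} (Z : normedModType R[i]) : Prop :=
  forall (phi : {linear Z -> R[i]^o}) (u h : Z) (e : R),
    continuous phi -> u != 0 -> rnorm h <= 1 -> 0 < e ->
  exists y, [/\ rnorm y <= 1, complex.Re (phi h) - e < complex.Re (phi y) &
    1 + rnorm u - e < rnorm (y + u)].

Section Slices.
Context {R : realType} {Z : normedModType R[i]}.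

(** The Daugavet equation is applied to [T y = (phi y / m) u], whose norm is that of [u]. If
    [y + T y] almost attains the norm of [Id + T], then [|phi y|] must be almost [m]; a phase on [y]
    makes [phi y] nonnegative, and [T y] is then close to [u]. *)
Lemma slice_of_daugavet : daugavet Z -> daugavet_slice Z.
Proof.
move=> dZ phi u h e cphi u0 h1 e0.
set m := ball_sup (fun w => rnorm (phi w)).
have phim z : rnorm (phi z) <= m * rnorm z by exact: rnorm_le_ball_sup.
have nu0 : 0 < rnorm u by rewrite rnorm_gt0.
(* If [phi] vanishes, [T] is not of rank one; the normalised [u] is then a direct witness. *)
have [m0|m0] := leP m 0.
  have phi0 z : phi z = 0.
    apply/eqP; rewrite -(@rnorm_eq0 R R[i]^o) eq_le rnorm_ge0 andbT.
    by apply: le_trans (phim z) _; rewrite mulr_le0_ge0 ?rnorm_ge0.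
  exists ((rnorm u)^-1%:C *: u); rewrite !phi0; split.
  - by rewrite rnormZr ger0_norm ?invr_ge0 ?rnorm_ge0// mulVf// gt_eqF.
  - by rewrite ltrBlDr ltrDl.
  - rewrite -[X in rnorm (_ + X)]scale1r -scalerDl -(rmorph1 (real_complex R)) -rmorphD.
    rewrite rnormZr ger0_norm ?addr_ge0 ?invr_ge0 ?rnorm_ge0//.
    by rewrite mulrDl mulVf ?gt_eqF// mul1r ltrBlDr ltrDl.
pose T y := (phi y / m%:C) *: u.
have Tlin : linear T by move=> a y z; rewrite /T linearP mulrDl scalerDl -mulrA scalerA.
pose TL : {linear Z -> Z} := HB.pack T (GRing.isLinear.Build _ _ _ _ T Tlin).
have TE y : rnorm (T y) = rnorm (phi y) / m * rnorm u.
  by rewrite /T rnormZ rnormM -fmorphV rnorm_real ger0_norm// invr_ge0 ltW.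
have Tu y : rnorm (T y) <= rnorm u * rnorm y.
  by rewrite TE mulrC ler_wpM2l ?rnorm_ge0// ler_pdivrMr// mulrC.
have cT : continuous TL by exact: (@linear_rnorm_continuous R Z Z TL (rnorm u) Tu).
have T1 : rank_one TL.
  exists u => //; apply/seteqP; split=> [_ [y _ <-]|_ [a _ <-]] /=.
    by exists (phi y / m%:C).
  have [z z1 phiz] := ball_sup_adherent m0.
  have phiz0 : phi z != 0 by rewrite -(@rnorm_gt0 R R[i]^o).
  have mC0 : m%:C != 0 :> R[i].
    by rewrite -(@rnorm_gt0 R R[i]^o) rnorm_real normr_gt0 gt_eqF.
  exists ((a * m%:C / phi z) *: z) => //=.
  rewrite /TL /= /T linearZ /=; congr (_ *: _).
  by rewrite [_ *: _](divfK phiz0) mulfK.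
have uT : rnorm u <= opnorm TL.
  have Tb z : rnorm z <= 1 -> rnorm (T z) <= rnorm u.
    by move=> z1; apply: le_trans (Tu z) _; rewrite ler_piMr ?rnorm_ge0.
  have mT : m <= opnorm TL * m / rnorm u.
    apply: ball_sup_le => z z1; have := le_ball_sup Tb z1; rewrite TE -opnormE.
    by rewrite mulrAC ler_pdivrMr// ler_pdivlMr.
  by move: mT; rewrite ler_pdivlMr// mulrC ler_pM2r.
(* The first bound serves the norm of [y + u], where [d] is lost twice; the second serves the slice,
   where [(1 - s) * rnorm u < d] has to give [(1 - s) * m < e]. *)
pose d := Num.min (e / 2) (e * rnorm u / m).
have d0 : 0 < d by rewrite lt_min !divr_gt0 ?mulr_gt0.
have de : d <= e / 2 by rewrite ge_min lexx.
have dm : d * m <= e * rnorm u by rewrite -ler_pdivlMr// ge_min lexx orbT.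
have := dZ TL cT T1; rewrite opnormE => DT.
have /ball_sup_adherent[y y1 yT] :
    1 + rnorm u - d < ball_sup (fun z => rnorm (z + TL z)).
  by rewrite DT ltrBlDr -addrA ltrD2l (le_lt_trans uT)// ltrDl.
have [c c1 cphiy] := ex_phase (phi y).
set s := rnorm (phi y) / m.
have sm : s * m = rnorm (phi y) by rewrite divfK// gt_eqF.
have s1 : s <= 1.
  rewrite ler_pdivrMr// mul1r; apply: le_trans (phim y) _.
  by rewrite ler_piMr// ltW.
have phicy : phi (c *: y) = (rnorm (phi y))%:C by rewrite linearZ.
have cyT : c *: (y + TL y) = c *: y + s%:C *: u.
  rewrite scalerDr; congr (_ + _); rewrite /TL/= /T scalerA; congr (_ *: _).
  by rewrite mulrA cphiy -fmorphV -rmorphM.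
have ncy : rnorm (c *: y) <= 1 by rewrite rnormZ c1 mul1r.
have {}yT : 1 + rnorm u - d < rnorm (c *: y + s%:C *: u).
  by rewrite -cyT rnormZ c1 mul1r.
have s0 : 0 <= s by rewrite divr_ge0 ?rnorm_ge0// ltW.
have su : (1 - s) * rnorm u < d.
  have := rnormD (c *: y) (s%:C *: u); rewrite rnormZr (ger0_norm s0); lra.
exists (c *: y); split=> //.
- rewrite phicy/= -sm; apply: (@le_lt_trans _ _ (m - e)).
    rewrite lerD2r; apply: le_trans (ler_Re_rnorm (phi h)) _.
    by apply: le_trans (phim h) _; rewrite ler_piMr// ltW.
  have sue : (1 - s) * m * rnorm u < e * rnorm u.
    apply: lt_le_trans dm; rewrite mulrAC -subr_gt0 -mulrBl.
    by rewrite mulr_gt0// subr_gt0.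
  by move: sue; rewrite ltr_pM2r// mulrBl mul1r; lra.
- have -> : c *: y + u = c *: y + s%:C *: u - (s - 1)%:C *: u.
    by rewrite -addrA -scalerBl -rmorphB/= opprB [s + _]addrC subrK scale1r.
  apply: lt_le_trans (rnorm_leB _ _).
  by rewrite rnormZr ler0_norm ?subr_le0// opprB; lra.
Qed.

(** Write [T] as [w |-> phi w *: f] with [rnorm f = opnorm T], so that [phi] is bounded by 1 on the
    ball. The slice property at an almost norming point of [phi] gives [g] with [phi g] close to 1;
    then [g + T g] is close to [g + f], whose norm is almost [1 + opnorm T]. *)
Lemma daugavet_of_slice : daugavet_slice Z -> daugavet Z.
Proof.
move=> sZ T cT [z z0 rT]; set M := opnorm T.
have TM w : rnorm (T w) <= M * rnorm w by exact: rnorm_le_ball_sup.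
have nz0 : 0 < rnorm z by rewrite rnorm_gt0.
have M0 : 0 < M.
  have [w _ Tw] : range T z by rewrite rT; exists 1 => //; rewrite scale1r.
  rewrite ltNge; apply/negP => M0; have := TM w; rewrite Tw leNgt => /negP; apply.
  by apply: le_lt_trans nz0; rewrite mulr_le0_ge0 ?rnorm_ge0.
pose f : Z := (M / rnorm z)%:C *: z.
have nf : rnorm f = M.
  by rewrite rnormZr ger0_norm ?divr_ge0 ?rnorm_ge0 ?(ltW M0)// divfK// gt_eqF.
have f0 : f != 0 by rewrite -rnorm_gt0 nf.
have /choice[phi Tphi] w : exists a : R[i], T w = a *: f.
  have [a _ Tw] : range (fun a : R[i] => a *: z) (T w) by rewrite -rT; exists w.
  exists (a / (M / rnorm z)%:C); rewrite /f scalerA divfK ?Tw//.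
  by rewrite -(@rnorm_gt0 R R[i]^o) rnorm_real normr_gt0 gt_eqF// divr_gt0.
(* The coefficient comes from a choice, but it is unique since [f != 0], hence linear. *)
have philin : linear (phi : Z -> R[i]^o).
  move=> a v w; apply/eqP; rewrite -subr_eq0.
  suff : (phi (a *: v + w) - (a *: (phi v : R[i]^o) + phi w)) *: f == 0.
    by rewrite scaler_eq0 (negPf f0) orbF.
  by rewrite scalerBl scalerDl -scalerA -!Tphi linearP subrr.
pose phiL : {linear Z -> R[i]^o} := HB.pack phi (GRing.isLinear.Build _ _ _ _ phi philin).
have nT w : rnorm (T w) = rnorm (phi w : R[i]^o) * M by rewrite Tphi rnormZ nf.
have phi1 w : rnorm (phi w : R[i]^o) <= rnorm w.
  by have := TM w; rewrite nT mulrC ler_pM2l.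
have cphi : continuous phiL.
  by apply: (@linear_rnorm_continuous R Z _ phiL 1) => w; rewrite mul1r; exact: phi1.
have ITb w : rnorm w <= 1 -> rnorm (w + T w) <= 1 + M.
  move=> w1; apply: le_trans (rnormD _ _) _; apply: lerD => //.
  by apply: le_trans (TM w) _; rewrite ler_piMr// ltW.
apply/eqP; rewrite eq_le; apply/andP; split; first exact: ball_sup_le ITb.
apply/ler_addgt0Pr => e e0.
pose t := Num.min 1 (e / (1 + M)).
have M1 : 0 < 1 + M by rewrite addr_gt0.
have t0 : 0 < t by rewrite lt_min ltr01 divr_gt0.
have t1 : t <= 1 by rewrite ge_min lexx.
have te : t * (1 + M) <= e by rewrite -ler_pdivlMr// ge_min lexx orbT.
(* From [|phi g| <= 1] and [Re (phi g) > 1 - 2 k] follows [|phi g - 1|^2 <= 2 - 2 Re (phi g) < 4 k],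
   and [4 k] is [t ^+ 2]. *)
pose k := t ^+ 2 / 4.
have k0 : 0 < k by rewrite divr_gt0 ?exprn_gt0.
have kt : k <= t by rewrite /k; nra.
have [v v1 Tv] : exists2 v, rnorm v <= 1 & M - M * k < rnorm (T v).
  by apply: ball_sup_adherent; rewrite ltrBlDr ltrDl mulr_gt0.
have {}Tv : 1 - k < rnorm (phi v : R[i]^o).
  by move: Tv; rewrite nT -[X in X - _]mulr1 -mulrBr mulrC ltr_pM2r.
have [c c1 cphiv] := ex_phase (phi v).
have cv1 : rnorm (c *: v) <= 1 by rewrite rnormZ c1 mul1r.
have [g [g1 gphi gf]] := sZ phiL f (c *: v) k cphi f0 cv1 k0.
have {}gphi : 1 - 2 * k < complex.Re (phi g).
  move: gphi; rewrite linearZ/= [_ *: _]cphiv/=; lra.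
have phig1 : rnorm (phi g : R[i]^o) <= 1 by exact: le_trans (phi1 g) g1.
have gt_ : rnorm (phi g - 1 : R[i]^o) <= t.
  rewrite -(@ler_pXn2r _ 2) ?nnegrE ?rnorm_ge0 ?(ltW t0)//.
  have : rnorm (phi g : R[i]^o) ^+ 2 <= 1 by rewrite exprn_ile1 ?rnorm_ge0.
  rewrite !rnorm_sqr raddfB/= raddfB/= subr0 /=.
  move: gphi; rewrite /k; nra.
apply: le_trans (_ : rnorm (g + T g) + t * M + k <= _); last first.
  rewrite -addrA; apply: lerD; first exact: (le_ball_sup ITb).
  by apply: le_trans te; rewrite mulrDr mulr1 addrC lerD2r.
have -> : g + T g = g + f - (1 - phi g) *: f.
  by rewrite Tphi scalerBl scale1r opprB -addrA [f + _]addrC subrK.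
rewrite -lerBlDr -lerBlDr; apply: le_trans (rnorm_leB _ _).
rewrite rnormZ nf (@rnorm_distC R R[i]^o).
have : rnorm (phi g - 1 : R[i]^o) * M <= t * M by rewrite ler_pM2r.
by move: gf; rewrite nf; lra.
Qed.

Lemma daugavet_sliceP : daugavet Z <-> daugavet_slice Z.
Proof. by split; [exact: slice_of_daugavet|exact: daugavet_of_slice]. Qed.

End Slices.

(** * Peak points of a uniform algebra *)

Section CspaceNorm.
Context {R : realType} {K : topologicalType} {Kc : compact [set: K]}.
Context {X : normedModType R[i]}.
Implicit Types f : cspace Kc X.

Lemma rnorm_cspace_continuous f : continuous (fun t => rnorm (f t)).
Proof.
by move=> t; apply: continuous_comp; [exact: cspace_cts|exact: rnorm_continuous].
Qed.

Lemma open_rnorm_lt f (M : R) : open [set t | rnorm (f t) < M].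
Proof.
apply: (@open_comp _ _ (fun t => rnorm (f t)) [set r | r < M]); last exact: open_lt.
by move=> t _; exact: rnorm_cspace_continuous.
Qed.

Lemma closed_rnorm_le f (M : R) : closed [set t | rnorm (f t) <= M].
Proof.
apply: (@closed_comp _ _ (fun t => rnorm (f t)) [set r | r <= M]); last exact: closed_le.
by move=> t _; exact: rnorm_cspace_continuous.
Qed.

Lemma cspace_rnorm_max f (P : set K) : closed P -> P !=set0 ->
  exists2 q, P q & forall t, P t -> rnorm (f t) <= rnorm (f q).
Proof.
move=> cP P0; have cptP : compact P by exact: subclosed_compact cP Kc _.
have [|q /set_mem Pq qmax] := @compact_EVT_max _ R (fun t => rnorm (f t)) P P0 cptP.
  by apply: continuous_subspaceT; exact: rnorm_cspace_continuous.
by exists q => // t Pt; apply: qmax; exact: mem_set.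
Qed.

End CspaceNorm.

Lemma exists_expr_lt {R : realType} (r d : R) : 0 <= r -> r < 1 -> 0 < d ->
  exists n, r ^+ n < d.
Proof.
move=> r0 r1 d0; have nr : `|r| < 1 by rewrite ger0_norm.
have /cvgrPdist_lt/(_ _ d0)[N _ /(_ N (leqnn N))] := cvg_expr nr.
by rewrite /= sub0r normrN ger0_norm ?exprn_ge0// => ?; exists N.
Qed.

Section PeakSet.
Context {R : realType} {K : topologicalType} {Kc : compact [set: K]}.
Local Notation CK := (cspace Kc R[i]^o).
Variable A : set CK.
Hypothesis ualgA : uniform_algebra A.

Let ualgD (a b : CK) : A a -> A b -> A (a + b).
Proof. by case: ualgA => _ lin _ _ _ Aa Ab; rewrite -[a]scale1r; exact: lin. Qed.

Let ualg1 : A (cspace_cst (1 : R[i]^o)).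
Proof. by case: ualgA. Qed.

Let ualgZ (c : R[i]) (a : CK) : A a -> A (c *: a).
Proof.
case: ualgA => _ lin _ cst _ Aa; rewrite -[c *: a]addr0.
rewrite (_ : 0 = cspace_cst (0 : R[i]^o)); first exact: lin.
exact: cspaceP.
Qed.

Let ualgM (a b : CK) : A a -> A b -> A (cspace_scale a b).
Proof. by case: ualgA => _ _ mul _ _; exact: mul. Qed.

Let ualgX (a : CK) n : A a -> exists2 b, A b & forall t, b t = (a t : R[i]) ^+ n.
Proof.
move=> Aa; elim: n => [|n [b Ab bE]].
  by exists (cspace_cst (1 : R[i]^o)) => // t; rewrite expr0.
exists (cspace_scale a b); first exact: ualgM.
by move=> t; rewrite exprS -bE.
Qed.

(* Weaker than P being an intersection of peak sets: the peaking function only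
   has to be close to 1 on P. *)
Definition peaks_near (P : set K) := forall (U : set K) (d : R),
  open U -> P `<=` U -> 0 < d -> exists a : CK,
  [/\ A a, forall t, rnorm (a t) <= 1, forall t, P t -> rnorm (a t - 1) < d &
      forall t, ~ U t -> rnorm (a t) < d].

Definition peak_set P := [/\ closed P, P !=set0 & peaks_near P].

Lemma peak_setT : [set: K] !=set0 -> peak_set [set: K].
Proof.
move=> K0; split=> [//|//|U d oU TU d0].
exists (cspace_cst (1 : R[i]^o)); split=> [//|t|t _|t /(_ (TU t I))//].
  by rewrite /= rnorm1.
by rewrite /= subrr rnorm0.
Qed.

(** Strict convexity of the disc: the midpoint of two distinct points of it is interior. *)
Lemma half_one_add_lt1 (z : R[i]) : rnorm (z : R[i]^o) <= 1 -> z != 1 ->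
  rnorm ((1 + z) / 2 : R[i]^o) < 1.
Proof.
move=> z1 zn1; rewrite -(@expr_lt1 _ 2) ?rnorm_ge0//.
have : rnorm (z : R[i]^o) ^+ 2 <= 1 by rewrite exprn_ile1 ?rnorm_ge0.
have halfE : (1 + z) / 2 = ((1 + complex.Re z) / 2) +i* (complex.Im z / 2).
  rewrite -[2](rmorph_nat (real_complex R)) -fmorphV; case: z {z1 zn1} => x y.
  by apply/eqP; rewrite eq_complex /=; apply/andP; split; apply/eqP; ring.
rewrite halfE !rnorm_sqr /=; case: z zn1 {halfE z1} => x y.
rewrite eq_complex /= => zn1 xy; have xy0 : x < 1.
  rewrite ltNge; apply/negP => x1; move/negP: zn1; apply.
  have y0 : y ^+ 2 = 0 by apply/eqP; rewrite eq_le sqr_ge0 andbT; nra.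
  have /eqP -> : y == 0 by rewrite -sqrf_eq0 y0.
  by rewrite eqxx andbT; apply/eqP; nra.
nra.
Qed.

(** On [P], the function [h = (1 + b) / 2] has modulus 1 only where [b = 1], so a high power [c] of
    it is small on [P] off [U]. Outside [P] nothing bounds [c]; multiplying by a function [phi] that
    peaks near [P] repairs this. *)
Lemma peak_set_refine P (b : CK) : peak_set P -> A b ->
  (forall t, P t -> rnorm (b t) <= 1) -> (exists2 t, P t & b t = 1) ->
  peak_set (P `&` [set t | b t = 1]).
Proof.
move=> [cP P0 pP] Ab b1 [q Pq bq].
have bset : [set t | b t = 1] =
    [set t | rnorm ((b - cspace_cst (1 : R[i]^o)) t) <= 0].
  apply/seteqP; split=> t /=.
    by move=> bt; rewrite [X in rnorm X](_ : _ = b t - 1)// bt subrr rnorm0.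
  move=> bt; apply/eqP; rewrite -subr_eq0 -(@rnorm_eq0 R R[i]^o) eq_le rnorm_ge0.
  by rewrite andbT.
split; first by rewrite bset; apply: closedI => //; exact: closed_rnorm_le.
  by exists q.
move=> U d oU QU d0.
pose h : CK := 2^-1 *: (cspace_cst (1 : R[i]^o) + b).
have Ah : A h by apply/ualgZ/ualgD.
have hE t : h t = (1 + b t) / 2 by rewrite mulrC.
have h_lt1 t : P t -> ~ U t -> rnorm (h t) < 1.
  move=> Pt nUt; rewrite hE; apply: half_one_add_lt1; first exact: b1.
  by apply/eqP => bt; apply: nUt; apply: QU.
have h_le1 t : P t -> rnorm (h t) <= 1.
  move=> Pt; rewrite hE; have [->|bt] := eqVneq (b t) 1.
    by rewrite divff ?rnorm1//; rewrite -natrD pnatr_eq0.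
  by apply/ltW/half_one_add_lt1 => //; exact: b1.
pose e := Num.min 1 (d / 2).
have e0 : 0 < e by rewrite lt_min ltr01 divr_gt0.
have ed : 2 * e <= d by rewrite mulrC -ler_pdivlMr// ge_min lexx orbT.
(* By compactness [h] has a maximal modulus on [P] minus [U], and it is below 1; if that set is
   empty, any exponent will do. *)
have [n hn] : exists n, forall t, P t -> ~ U t -> rnorm (h t) ^+ n < e.
  have [PU0|/set0P/negP/negPn/eqP PU0] := pselect (P `\` U !=set0); last first.
    by exists 0 => t Pt nUt; have : (P `\` U) t by []; rewrite PU0.
  have [|p [Pp nUp] pmax] := cspace_rnorm_max h _ PU0.
    by apply: closedI => //; exact: open_closedC.
  have [n hpn] := exists_expr_lt (rnorm_ge0 _) (h_lt1 _ Pp nUp) e0.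
  exists n => t Pt nUt; apply: le_lt_trans hpn.
  by rewrite lerXn2r ?nnegrE ?rnorm_ge0// pmax.
have [c Ac cE] := ualgX n Ah.
have ncE t : rnorm (c t) = rnorm (h t) ^+ n.
  rewrite cE; elim: n {hn cE Ac} => [|n IH]; first by rewrite !expr0 rnorm1.
  by rewrite !exprS rnormM IH.
(* An open set around [P] on which [c] still obeys, up to [e], the bounds known on [P]. *)
pose V := [set t | rnorm (c t) < 1 + e] `&` (U `|` [set t | rnorm (c t) < e]).
have oV : open V.
  by apply: openI; [exact: open_rnorm_lt|apply: openU => //; exact: open_rnorm_lt].
have PV : P `<=` V.
  move=> t Pt; split=> /=.
    apply: le_lt_trans (_ : 1 < _); last by rewrite ltrDl.
    by rewrite ncE exprn_ile1 ?rnorm_ge0 ?h_le1.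
  by have [Ut|nUt] := pselect (U t); [left|right; rewrite /= ncE hn].
pose M := 1 + supnorm c.
have M0 : 0 < M by rewrite ltr_wpDr ?supnorm_ge0.
have cM t : rnorm (c t) <= M.
  by apply: le_trans (rnorm_le_supnorm c t) _; rewrite lerDr.
(* The bound [e / M] makes the product with [c] smaller than [e] off [V]. *)
have [|phi [Aphi phi1 phiP phiV]] := pP V (Num.min e (e / M)) oV PV.
  by rewrite lt_min e0 divr_gt0.
have cphi t : ~ V t -> rnorm (phi t * c t : R[i]^o) < e.
  move=> /phiV; rewrite lt_min rnormM => /andP[_ pe].
  have [->|ct0] := eqVneq (rnorm (c t)) 0; first by rewrite mulr0.
  have ct : 0 < rnorm (c t) by rewrite lt_def ct0 rnorm_ge0.
  apply: lt_le_trans (_ : e / M * M <= _); last by rewrite divfK// gt_eqF.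
  apply: lt_le_trans (_ : e / M * rnorm (c t) <= _); first by rewrite ltr_pM2r.
  by rewrite ler_wpM2l// divr_ge0 ?ltW.
have e1 : 0 < 1 + e by rewrite addr_gt0.
have phile t : rnorm (phi t * c t : R[i]^o) <= rnorm (c t).
  by rewrite rnormM ler_piMl ?rnorm_ge0.
(* The product may reach [1 + e] on [V]; rescaling restores the bound 1 and costs at most another
   [e] on the peak set, whence [2 * e <= d]. *)
exists ((1 + e)^-1%:C *: cspace_scale phi c).
have vE t : ((1 + e)^-1%:C *: cspace_scale phi c) t =
    (1 + e)^-1%:C *: (phi t * c t : R[i]^o) by [].
split=> [|t|t [Pt bt]|t nUt]; first by apply/ualgZ/ualgM.
- rewrite vE rnormZr ger0_norm ?invr_ge0 ?(ltW e1)// mulrC ler_pdivrMr// mul1r.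
  have [[ct _]|/cphi ct] := pselect (V t); first exact: le_trans (phile t) (ltW ct).
  by apply/ltW/(lt_trans ct); rewrite ltrDr.
- have ct1 : c t = 1.
    rewrite cE hE (_ : b t = 1)//.
    by rewrite divff ?expr1n//; rewrite -natrD pnatr_eq0.
  rewrite vE ct1 mulr1.
  have -> : (1 + e)^-1%:C *: (phi t : R[i]^o) - 1 =
      (1 + e)^-1%:C *: ((phi t - 1) - e%:C : R[i]^o).
    rewrite [RHS](_ : _ = (1 + e)^-1%:C *: (phi t - (1 + e)%:C : R[i]^o)).
      rewrite scalerBr; congr (_ - _).
      rewrite [RHS](_ : _ = (1 + e)^-1%:C * (1 + e)%:C)//.
      by rewrite -rmorphM mulVf ?gt_eqF.
    by congr (_ *: _); rewrite rmorphD opprD addrA.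
  rewrite rnormZr ger0_norm ?invr_ge0 ?(ltW e1)// mulrC ltr_pdivrMr//.
  apply: le_lt_trans (rnormD _ _) _; rewrite rnormN rnorm_real (ger0_norm (ltW e0)).
  have := phiP t Pt; rewrite lt_min => /andP[pe _].
  by rewrite mulrDr mulr1; nra.
- rewrite vE rnormZr ger0_norm ?invr_ge0 ?(ltW e1)// mulrC ltr_pdivrMr//.
  suff : rnorm (phi t * c t : R[i]^o) < e by nra.
  have [[_ [//|ct]]|/cphi//] := pselect (V t).
  exact: le_lt_trans (phile t) ct.
Qed.

(** By compactness, an open set containing the intersection already contains a member of the chain,
    whose peaking functions then serve for the intersection. *)
Lemma peak_set_chain (C : set (set K)) : C !=set0 ->
  (forall P, C P -> peak_set P) -> total_on C subset ->
  peak_set (\bigcap_(P in C) P).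
Proof.
move=> [P0 CP0] Cpeak Ctot.
have sub U : open U -> \bigcap_(P in C) P `<=` U -> exists2 P, C P & P `<=` U.
  move=> oU CU; apply: contrapT => nCU.
  have FF : Filter (filter_from C (fun P => P `\` U)).
    apply: filter_from_filter; first by exists P0.
    move=> P Q CP CQ; have [PQ|QP] := Ctot _ _ CP CQ.
      by exists P => // t [Pt Ut]; split; split=> //; exact: PQ.
    by exists Q => // t [Qt Ut]; split; split=> //; exact: QP.
  have PF : ProperFilter (filter_from C (fun P => P `\` U)).
    apply: filter_from_proper => P CP; apply: contrapT => PU0; apply: nCU.
    by exists P => // t Pt; apply: contrapT => nUt; apply: PU0; exists t.
  have [|t [_ clt]] := Kc PF; first exact: filterT.
  have tPU P : C P -> (P `\` U) t.
    move=> CP; have cPU : closed (P `\` U).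
      by apply: closedI; [case: (Cpeak _ CP)|exact: open_closedC].
    by rewrite clusterE in clt; apply: cPU; apply: clt; exists P.
  by have [_] := tPU _ CP0; apply; apply: CU => P /tPU[].
split.
- by apply: closed_bigI => P /Cpeak[].
(* An empty intersection would lie in the open set [set0], and so would some member of the chain. *)
- apply: contrapT => C0; have [|t Ct|P CP P0'] := sub set0; first exact: open0.
    by apply: C0; exists t.
  by have [_ [t /P0']] := Cpeak _ CP.
- move=> U d oU CU d0; have [P CP PU] := sub U oU CU.
  have [_ _ /(_ U d oU PU d0)[a [Aa a1 aP aU]]] := Cpeak _ CP.
  by exists a; split=> // t Ct; apply: aP; exact: Ct.
Qed.

(** A minimal peak set [Q] is a singleton: for distinct [s] and [t] in [Q], a function of [A] that
    vanishes at [s] but not at [t], normalised at a maximum point of its modulus on [Q], refines [Q]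
    to a peak set without [s]. *)
Lemma peak_set_point P : peak_set P -> exists2 t, P t & peak_set [set t].
Proof.
move=> pP; pose T := {Q : set K | peak_set Q /\ Q `<=` P}.
pose mk Q (pQ : peak_set Q) (QP : Q `<=` P) : T := exist _ Q (conj pQ QP).
pose rT (Q1 Q2 : T) := `[< sval Q2 `<=` sval Q1 >].
have [|||[Q [pQ QP]] Qmin] := @ZL_preorder T (mk P pP (@subset_refl _ P)) rT.
- by move=> Q; apply/asboolP.
- move=> Q1 Q2 Q3 /asboolP Q12 /asboolP Q23; apply/asboolP.
  exact: subset_trans Q23 Q12.
- move=> C Ctot; have [[Q0 CQ0]|/set0P/negP/negPn/eqP ->] :=
    pselect (C !=set0); last first.
    by exists (mk P pP (@subset_refl _ P)).
  have pC : peak_set (\bigcap_(Q in [set sval Q | Q in C]) Q).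
    apply: peak_set_chain; first by exists (sval Q0), Q0.
      by move=> _ [Q CQ <-]; exact: (svalP Q).1.
    move=> _ _ [Q1 CQ1 <-] [Q2 CQ2 <-].
    by have [/asboolP|/asboolP] := Ctot _ _ CQ1 CQ2; [right|left].
  have CP : \bigcap_(Q in [set sval Q | Q in C]) Q `<=` P.
    by move=> t Ct; apply: (svalP Q0).2; apply: Ct; exists Q0.
  exists (mk _ pC CP) => Q CQ; apply/asboolP => t /= Ct.
  by apply: Ct; exists Q.
have [cQ [s Qs] _] := pQ; exists s; first exact: (QP s Qs).
suff -> : [set s] = Q by [].
apply/seteqP; split=> [_ ->//|t Qt] /=; apply: contrapT => ts.
have [b0 Ab0 bst] : exists2 b, A b & b t <> b s by case: ualgA => _ _ _ _; apply.
pose b : CK := b0 + (- b0 s) *: cspace_cst (1 : R[i]^o).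
have Ab : A b by apply: ualgD => //; exact: ualgZ.
have bE u : b u = b0 u - b0 s by rewrite [LHS](_ : _ = b0 u + - b0 s * 1)// mulr1.
have [q Qq bq] := cspace_rnorm_max b cQ (ex_intro _ s Qs).
have bq0 : 0 < rnorm (b q).
  apply: lt_le_trans (bq _ Qt); rewrite rnorm_gt0 bE subr_eq0; exact/eqP.
have bqn0 : b q != 0 by rewrite -rnorm_gt0.
pose c : CK := (b q)^-1 *: b.
have cE u : c u = (b q)^-1 * b u by [].
have pc : peak_set (Q `&` [set u | c u = 1]).
  apply: peak_set_refine => //; first exact: ualgZ.
    move=> u Qu; rewrite -(ler_pM2l bq0) mulr1 cE rnormM mulrA -rnormM divff//.
    by rewrite rnorm1 mul1r bq.
  by exists q => //; rewrite cE mulVf.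
have cP : Q `&` [set u | c u = 1] `<=` P.
  by move=> u [Qu _]; exact: (svalP (mk Q pQ QP)).2.
have cle : rT (mk Q pQ QP) (mk _ pc cP).
  by apply/asboolP => u [].
have /asboolP/(_ _ Qs)[_ cs] := Qmin _ cle.
by have /eqP : c s = 1 by []; rewrite cE (bE s) subrr mulr0 eq_sym oner_eq0.
Qed.

(** Divided by its value at a maximum point of its modulus, [a] equals 1 on a peak set; a peak point
    inside it is again a maximum point. If [a] is zero, every peak point qualifies. *)
Lemma peak_point_max (a : CK) : [set: K] !=set0 -> A a ->
  exists2 q, peak_set [set q] & forall t, rnorm (a t) <= rnorm (a q).
Proof.
move=> K0 Aa; have [q _ aq] := cspace_rnorm_max a closedT K0.
have [aq0|aq0] := eqVneq (a q) 0.
  have [p _ pp] := peak_set_point (peak_setT K0).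
  by exists p => // t; apply: le_trans (aq t I) _; rewrite aq0 rnorm0 rnorm_ge0.
have naq0 : 0 < rnorm (a q) by rewrite rnorm_gt0.
pose c : CK := (a q)^-1 *: a.
have cE u : c u = (a q)^-1 * a u by [].
have [|p [_ cp] pp] := @peak_set_point ([set: K] `&` [set u | c u = 1]).
  apply: peak_set_refine => //; [exact: peak_setT|exact: ualgZ| |].
    move=> u _; rewrite -(ler_pM2l naq0) mulr1 cE rnormM mulrA -rnormM divff//.
    by rewrite rnorm1 mul1r aq.
  by exists q => //; rewrite cE mulVf.
exists p => // t; suff -> : a p = a q by exact: aq.
by rewrite -[LHS]mul1r -(divff aq0) -mulrA -cE cp mulr1.
Qed.

(** The sum of [n] peaking functions, each chosen for a neighbourhood where the preceding ones are
    close to 1. At any point at most one of them is in transition: those before it are near 1 ([s]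
    counts them), those after it near 0. *)
Lemma peak_point_staircase p n (U : set K) (d : R) : peak_set [set p] ->
  open U -> U p -> 0 < d -> exists a : CK,
  [/\ A a, rnorm (a p - n%:R) < d, forall t, ~ U t -> rnorm (a t) < d &
     forall t, exists s : R, [/\ 0 <= s, s <= n%:R & rnorm (a t - s%:C) <= 1 + d]].
Proof.
move=> [_ _ pp]; elim: n U d => [|n IH] U d oU Up d0.
  exists (0 *: cspace_cst (1 : R[i]^o)); split.
  - exact: ualgZ.
  - by rewrite [X in rnorm X](_ : _ = 0 * 1 - 0)// mul0r subrr rnorm0.
  - by move=> t _; rewrite [X in rnorm X](_ : _ = 0 * 1)// mul0r rnorm0.
  - move=> t; exists 0; split=> //.
    rewrite [X in rnorm X](_ : _ = 0 * 1 - 0)// mul0r subrr rnorm0.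
    by rewrite addr_ge0 ?ltW.
have d2 : 0 < d / 2 by rewrite divr_gt0.
have [|phi [Aphi phi1 /(_ p erefl) phip phiU]] := pp U (d / 2) oU _ d2.
  by move=> _ ->.
pose V := U `&` [set t | rnorm ((phi - cspace_cst (1 : R[i]^o)) t) < d / 2].
have oV : open V by apply: openI => //; exact: open_rnorm_lt.
have [//|a [Aa ap aV aS]] := IH V (d / 2) oV _ d2.
have aE t : (phi + a) t = (phi t : R[i]) + a t by [].
exists (phi + a); split=> [|| t nUt|t]; first exact: ualgD.
- have -> : (phi + a) p - n.+1%:R = (phi p - 1 : R[i]) + (a p - n%:R).
    by rewrite aE -natr1; ring.
  by have := rnormD (phi p - 1 : R[i]^o) (a p - n%:R); lra.
- have := phiU t nUt; have /aV : ~ V t by case.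
  by rewrite aE; have := rnormD (phi t : R[i]^o) (a t); lra.
- have [[Ut phit]|nVt] := pselect (V t).
    have [s [s0 sn as_]] := aS t; exists (s + 1); split.
    + by rewrite addr_ge0.
    + by rewrite -natr1 lerD2r.
    + have -> : (phi + a) t - (s + 1)%:C = (phi t - 1 : R[i]) + (a t - s%:C).
        by rewrite aE rmorphD rmorph1; ring.
      have : rnorm (phi t - 1 : R[i]^o) < d / 2 by [].
      by have := rnormD (phi t - 1 : R[i]^o) (a t - s%:C); lra.
  (* Off [V] the later functions are negligible, and [phi] alone contributes at most 1. *)
  exists 0; split=> //.
  rewrite subr0 aE.
  by have := rnormD (phi t : R[i]^o) (a t); have := phi1 t; have := aV t nVt; lra.
Qed.

(** Divided by [N], a staircase of [N] steps stays within [2 / N] of the real segment from 0 to 1,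
    on which [|r| + |1 - r| = 1]. The last condition confines the values of [a] to a thin ellipse
    with foci 0 and 1. *)
Lemma peak_point_stolz p (U : set K) (d : R) : peak_set [set p] ->
  open U -> U p -> 0 < d -> exists a : CK,
  [/\ A a, rnorm (a p - 1) < d, forall t, ~ U t -> rnorm (a t) < d &
     forall t, rnorm (a t) + rnorm (1 - a t) <= 1 + d].
Proof.
move=> pp oU Up d0; have [k] : exists k, 0 + k.+1%:R^-1 < d / 4.
  by apply: ltr_add_invr; rewrite divr_gt0.
rewrite add0r; set N := k.+1 => kd.
have N0 : 0 < N%:R :> R by rewrite ltr0n.
have Nd : 4 / N%:R <= d by rewrite mulrC -ler_pdivlMr// ltW.
pose e := Num.min 1 d.
have e0 : 0 < e by rewrite lt_min ltr01.
have ed : e <= d by rewrite ge_min lexx orbT.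
have e1 : e <= 1 by rewrite ge_min lexx.
have [a [Aa ap aU aS]] := peak_point_staircase N pp oU Up e0.
pose b : CK := N%:R^-1%:C *: a.
have Vle1 : N%:R^-1 <= 1 :> R by rewrite invf_le1// ler1n.
have bE t : b t = N%:R^-1%:C *: a t by [].
have NV : `|N%:R^-1 : R| = N%:R^-1 by rewrite ger0_norm// invr_ge0 ltW.
have bsub t (s : R) : rnorm (b t - (s / N%:R)%:C) = N%:R^-1 * rnorm (a t - s%:C).
  rewrite -{2}NV -rnormZr scalerBr bE; congr (rnorm (_ - _)).
  by rewrite [RHS](_ : _ = N%:R^-1%:C * s%:C)// mulrC rmorphM.
exists b; split=> [||t nUt|t]; first exact: ualgZ.
- have := bsub p N%:R; rewrite divff ?gt_eqF// rmorph1 rmorph_nat => ->.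
  apply: le_lt_trans (_ : 1 * rnorm (a p - N%:R) < _).
    by rewrite ler_wpM2r ?rnorm_ge0.
  by rewrite mul1r (lt_le_trans ap).
- rewrite bE rnormZr NV; apply: le_lt_trans (_ : 1 * rnorm (a t) < _).
    by rewrite ler_wpM2r ?rnorm_ge0.
  by rewrite mul1r (lt_le_trans (aU t nUt)).
- have [s [s0 sN as_]] := aS t; set r := s / N%:R.
  have r0 : 0 <= r by rewrite divr_ge0 ?(ltW N0).
  have r1 : r <= 1 by rewrite ler_pdivrMr ?mul1r.
  have br : rnorm (b t - r%:C) <= 2 / N%:R.
    by rewrite bsub mulrC ler_pM2r ?invr_gt0//; lra.
  have := rnormD (b t - r%:C : R[i]^o) r%:C; rewrite subrK rnorm_real (ger0_norm r0).
  have := rnormD (r%:C - b t : R[i]^o) (1 - r)%:C.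
  rewrite rnorm_real ger0_norm ?subr_ge0// (@rnorm_distC R R[i]^o).
  rewrite rmorphB rmorph1 addrC addrA subrK.
  move: br Nd; rewrite (_ : 4 = 2 + 2 :> R) ?mulrDl; last by rewrite -natrD.
  by lra.
Qed.

End PeakSet.

(** * The Daugavet property of A(K, X) *)

(** A witness slightly outside the ball is scaled back by [(1 + d)^-1], which moves it by at most
    [d]. *)
Lemma daugavet_slice_approx {R : realType} {Z : normedModType R[i]} :
  (forall (phi : {linear Z -> R[i]^o}) (u h : Z) (e : R),
    continuous phi -> u != 0 -> rnorm h <= 1 -> 0 < e ->
    exists y, [/\ rnorm y <= 1 + e, complex.Re (phi h) - e < complex.Re (phi y) &
      1 + rnorm u - e < rnorm (y + u)]) ->
  daugavet_slice Z.
Proof.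
move=> apx phi u h e cphi u0 h1 e0; have [C C0 phiC] := continuous_linear_rnorm cphi.
have C1 : 0 < 2 * (1 + C) by rewrite mulr_gt0 ?addr_gt0.
(* The losses are [d + C * d] for the functional and [2 * d] for the norm; both stay below [e]. *)
pose d := e / (2 * (1 + C)).
have d0 : 0 < d by rewrite divr_gt0.
have dC : 2 * d + 2 * (C * d) = e.
  by rewrite -[RHS](divfK (lt0r_neq0 C1)) -/d; ring.
have Cd : 0 < C * d by rewrite mulr_gt0.
have {apx} [g [g1 phig gu]] := apx phi u h d cphi u0 h1 d0.
have D0 : 0 < 1 + d by rewrite addr_gt0.
pose k := (1 + d)^-1%:C *: g.
have gk : rnorm (g - k) <= d.
  rewrite -[X in X - _]scale1r -scalerBl -(rmorph1 (real_complex R)) -rmorphB.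
  have D1 : (1 + d)^-1 <= 1 by rewrite invf_le1// lerDl ltW.
  rewrite rnormZr ger0_norm ?subr_ge0//.
  apply: le_trans (ler_wpM2l _ g1) _; first by rewrite subr_ge0.
  by rewrite mulrBl mul1r mulVf ?gt_eqF// addrAC subrr add0r.
exists k; split.
- by rewrite rnormZr ger0_norm ?invr_ge0 ?(ltW D0)// mulrC ler_pdivrMr// mul1r.
- have := ler_Re_rnorm (phi (g - k)); have := phiC (g - k).
  have : C * rnorm (g - k) <= C * d by rewrite ler_pM2l.
  by rewrite linearB raddfB/=; lra.
- have := rnorm_leB (g + u) (g - k).
  by rewrite opprB [_ + (k - g)]addrC addrA subrK; lra.
Qed.

Section PeakCombination.
Context {R : realType} {X : normedModType R[i]}.
Implicit Types (a : R[i]) (v w y : X) (d : R).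

(** Where [v] is close to [w], the vector is nearly [(1 - a) v + a y], of norm at most
    [|1 - a| + |a|]; where [a] is small, it is nearly [v]. *)
Lemma peak_combination_le a v w y d : 0 <= d -> d <= 1 ->
  rnorm v <= 1 -> rnorm w <= 1 -> rnorm y <= 1 ->
  rnorm (a : R[i]^o) + rnorm (1 - a : R[i]^o) <= 1 + d ->
  rnorm (v - w) < d \/ rnorm (a : R[i]^o) < d ->
  rnorm (v + (a *: y - a *: w)) <= 1 + 3 * d.
Proof.
move=> d0 d1 v1 w1 y1 ad.
have a0 : 0 <= rnorm (a : R[i]^o) by exact: rnorm_ge0.
have a1 : 0 <= rnorm (1 - a : R[i]^o) by exact: rnorm_ge0.
have ay : rnorm (a *: y) <= rnorm (a : R[i]^o) by rewrite rnormZ ler_piMr.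
case=> [vw|ad'].
  have -> : v + (a *: y - a *: w) = (1 - a) *: v + a *: y + a *: (v - w).
    rewrite scalerBl scale1r scalerBr [X in _ = X + (_ - _)]addrAC.
    by rewrite -[RHS]addrA addKr addrA.
  have avw : rnorm (a *: (v - w)) <= (1 + d) * d.
    by rewrite rnormZ ler_pM ?rnorm_ge0// ?(ltW vw)//; lra.
  have av : rnorm ((1 - a) *: v) <= rnorm (1 - a : R[i]^o) by rewrite rnormZ ler_piMr.
  have d2 : d * d <= d by rewrite ler_piMr.
  apply: le_trans (rnormD _ _) _; apply: le_trans (lerD (rnormD _ _) (lexx _)) _.
  by rewrite mulrDl mul1r in avw; lra.
have aw : rnorm (a *: w) <= rnorm (a : R[i]^o) by rewrite rnormZ ler_piMr.
apply: le_trans (rnormD _ _) _; apply: le_trans (lerD (lexx _) (rnormD _ _)) _.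
by rewrite rnormN; lra.
Qed.

(** With [a] close to 1, [w + a (y - w)] differs from [y] by [(1 - a) (y - w)], and [y - w] has norm
    at most 2. *)
Lemma peak_combination_ge a w y z d : rnorm w <= 1 -> rnorm y <= 1 ->
  rnorm (a - 1 : R[i]^o) < d ->
  rnorm (y + z) - 2 * d <= rnorm (w + (a *: y - a *: w) + z).
Proof.
move=> w1 y1 ad.
have -> : w + (a *: y - a *: w) + z = (y + z) - (1 - a) *: (y - w).
  rewrite -scalerBr scalerBl scale1r opprB opprB; set b := a *: _.
  rewrite [y + _]addrC -[RHS]addrA [b + (_ - _)]addrA [y + _]addrC subrK.
  by rewrite addrC [w + _]addrC.
apply: le_trans (rnorm_leB _ _); rewrite rnormZ lerD2l lerN2 mulrC.
apply: ler_pM; rewrite ?rnorm_ge0//; last by rewrite (@rnorm_distC R R[i]^o) ltW.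
by apply: le_trans (rnormD _ _) _; rewrite rnormN (_ : 2 = 1 + 1 :> R) ?lerD// -natrD.
Qed.

End PeakCombination.

Lemma small_tolerance {R : realType} (e : R) : 0 < e ->
  exists d, [/\ 0 < d, d <= 1, 3 * d <= e & e / 4 + 2 * d <= e].
Proof.
move=> e0; pose d := Num.min 1 (e / 4); exists d.
have d0 : 0 < d by rewrite lt_min ltr01 divr_gt0.
have d1 : d <= 1 by rewrite ge_min lexx.
have de : d <= e / 4 by rewrite ge_min lexx orbT.
by split; lra.
Qed.

Section SliceOfAKX.
Context {R : realType} {K : topologicalType} {Kc : compact [set: K]}.
Context {X : normedModType R[i]} {S : submodClosed (cspace Kc X)}.
Hypothesis hS : is_AKX S.
Local Notation A := (base_algebra S).

Lemma rnorm_subspace (f : subspace_of S) : rnorm f = supnorm (val f).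
Proof. by []. Qed.

Lemma subspaceD (f g : subspace_of S) t : val (f + g) t = val f t + val g t.
Proof. by rewrite raddfD. Qed.

Lemma subspaceB (f g : subspace_of S) t : val (f - g) t = val f t - val g t.
Proof. by rewrite raddfB. Qed.

(** With [phi] norming [f q] at a maximum point [q], and [p] a peak point maximising [|phi (f t)|],
    one has [rnorm (f q) <= |phi (f q)| <= |phi (f p)| <= rnorm (f p)]. *)
Lemma norming_peak_point (f : cspace Kc X) : [set: K] !=set0 -> f \in S ->
  exists2 p, peak_set A [set p] & rnorm (f p) = supnorm f.
Proof.
move=> K0 Sf; have [q _ fq] := cspace_rnorm_max f closedT K0.
have [phi phile phiq] := norming_functional (f q).
have cphi : continuous phi.
  by apply: (@linear_rnorm_continuous R X _ phi 1) => x; rewrite mul1r.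
have ctsa : (fun t => phi (f t)) \in (cts_pred : {pred K -> R[i]^o}).
  by apply/cts_predP => t; apply: continuous_comp; [exact: cspace_cts|exact: cphi].
have Aa : A (CSpace Kc ctsa) by exists f, phi.
have uA : uniform_algebra A by case: hS.
have [p pp ap] := peak_point_max uA K0 Aa.
exists p => //; apply/eqP; rewrite eq_le rnorm_le_supnorm/=.
apply: supnorm_le => [|t]; first exact: rnorm_ge0.
apply: le_trans (fq t I) _; apply: le_trans phiq _.
exact: le_trans (ap q) (phile _).
Qed.

Lemma tensor_subproof (a : cspace Kc R[i]^o) (Aa : A a) (x : X) :
  cspace_scale a (cspace_cst x) \in S.
Proof. by case: hS => _ _ + _; exact. Qed.

(** Bundled as a linear map into the subspace, so that functionals on [subspace_of S] pull back to
    [X]. *)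
Definition tensor a (Aa : A a) (x : X) : subspace_of S :=
  SubspaceOf (tensor_subproof Aa x).

Lemma tensorE a (Aa : A a) x t : val (tensor Aa x) t = a t *: x.
Proof. by []. Qed.

Lemma tensor_linear a (Aa : A a) : linear (tensor Aa).
Proof.
move=> c x y; apply: val_inj; apply: cspaceP => t.
change (a t *: (c *: x + y) = c *: (a t *: x) + a t *: y).
by rewrite scalerDr !scalerA mulrC.
Qed.

HB.instance Definition _ a (Aa : A a) :=
  GRing.isLinear.Build _ _ _ _ (tensor Aa) (tensor_linear Aa).

Lemma daugavet_slice_AKX : daugavet_slice X -> daugavet_slice (subspace_of S).
Proof.
move=> sX; apply: daugavet_slice_approx => Phi u h e cPhi u0 h1 e0.
(* Over an empty [K] every function is zero, contradicting [u != 0]. *)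
have K0 : [set: K] !=set0.
  apply: contrapT => K0; move/eqP: u0; apply; apply: val_inj; apply: cspaceP => t.
  by case: K0; exists t.
have uA : uniform_algebra A by case: hS.
have [p pp fp] := norming_peak_point K0 (valP u).
have fp0 : val u p != 0 by rewrite -rnorm_gt0 fp -rnorm_subspace rnorm_gt0.
have [C C0 PhiC] := continuous_linear_rnorm cPhi.
have [d [d0 d1 de3 de2]] := small_tolerance e0.
(* On [U] the value [h t] is close to [h p], off [U] the function [a] is small: the two alternatives
   of [peak_combination_le]. *)
pose U := [set t | rnorm ((val h - cspace_cst (val h p)) t) < d].
have Up : U p by rewrite /U /= [X in rnorm X](_ : _ = val h p - val h p)// subrr rnorm0.
have [a [Aa ap aU aS]] := peak_point_stolz uA pp (open_rnorm_lt _ _) Up d0.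
have a_le t : rnorm (a t) <= 1 + d.
  by apply: le_trans (aS t); rewrite lerDl rnorm_ge0.
have nh t : rnorm (val h t) <= 1.
  by apply: le_trans h1; rewrite rnorm_subspace; exact: rnorm_le_supnorm.
pose xi : {linear X -> R[i]^o} := Phi \o tensor Aa.
have cxi : continuous xi.
  apply: (@linear_rnorm_continuous R X _ xi (C * (1 + d))) => x.
  apply: le_trans (PhiC _) _; rewrite -mulrA ler_pM2l// rnorm_subspace.
  apply: supnorm_le => [|t]; first by rewrite mulr_ge0 ?rnorm_ge0// addr_ge0// ltW.
  change (rnorm (a t *: x) <= (1 + d) * rnorm x).
  by rewrite rnormZ ler_wpM2r ?rnorm_ge0.
(* Since [p] is norming for [u], the vector [val u p] has the full norm of [u], so evaluation at [p]
   suffices to bound [g + u] from below. *)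
have [|y [y1 xiy yf]] := sX xi (val u p) (val h p) (e / 4) cxi fp0 (nh p).
  by rewrite divr_gt0.
pose g := h + (tensor Aa y - tensor Aa (val h p)).
have gE t : val g t = val h t + (a t *: y - a t *: val h p).
  by rewrite subspaceD subspaceB !tensorE.
have g1 : rnorm g <= 1 + 3 * d.
  rewrite rnorm_subspace; apply: supnorm_le => [|t].
    by rewrite addr_ge0 ?mulr_ge0// ltW.
  rewrite gE; apply: peak_combination_le (nh t) (nh p) y1 (aS t) _ => //.
    exact: ltW.
  by have [Ut|/aU nUt] := pselect (U t); [left|right].
have gu : 1 + rnorm u - e / 4 - 2 * d < rnorm (g + u).
  rewrite [X in _ < X]rnorm_subspace; apply: lt_le_trans (rnorm_le_supnorm _ p).
  rewrite subspaceD gE.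
  apply: lt_le_trans (peak_combination_ge (val u p) (nh p) y1 ap).
  by move: yf; rewrite fp -rnorm_subspace ltrD2r.
have PhigE : complex.Re (Phi g) =
    complex.Re (Phi h) + (complex.Re (xi y) - complex.Re (xi (val h p))).
  by rewrite linearD linearB raddfD raddfB.
exists g; split.
- by apply: le_trans g1 _; rewrite lerD2l.
- rewrite PhigE ltrD2l ltrBrDr addrC; apply: le_lt_trans xiy.
  by rewrite lerD2l lerN2 ler_pdivrMr// ler_peMr ?ler1n// ltW.
- by apply: le_lt_trans gu; rewrite -[leRHS]addrA -opprD lerD2l lerN2.
Qed.

End SliceOfAKX.

Theorem theorem3p17 (R : realType) (K : topologicalType)
    (Kc : compact [set: K]) (Kh : hausdorff_space K)
    (X : completeNormedModType R[i])
    (AKX : submodClosed (cspace Kc X)) (hAKX : is_AKX AKX) :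
  daugavet X -> daugavet (subspace_of AKX).
Proof.
by move=> /daugavet_sliceP dX; apply/daugavet_sliceP/daugavet_slice_AKX.
Qed.
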